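(* Let $\Lambda$ be a row-finite, source-free $k$-graph with no sinks, and let $\mu$ be a Radon measure on $\Lambda^\infty$ which gives rise to a $\Lambda$-projective system (with the standard prefixing and coding maps $\sigma_\lambda,\sigma^n$ and functions $f_\lambda$), with associated representation $\{T_\lambda:\lambda\in\Lambda\}$ on $L^2(\Lambda^\infty,\mu)$. Suppose $E\subseteq \Lambda^\infty$ is a minimal $\mu$-invariant subset. Then the restriction of $\{T_\lambda:\lambda\in\Lambda\}$ to $L^2(E,\mu)$ gives an irreducible representation of $C^*(\Lambda)$.
   Context: A $k$-graph is a countable small category $\Lambda$ with a functor $d:\Lambda\to\mathbb{N}^k$ with unique factorization; $\Lambda^0$ vertices, $r,s$ range/source, $v\Lambda^n$ (resp. $\Lambda^n v$) paths of degree $n$ with range (resp. source) $v$. Row-finite: $v\Lambda^n$ finite; source-free: $v\Lambda^n\ne\emptyset$; no sinks: $\Lambda^{e_i}v\ne\emptyset$ for every basis vector $e_i$ and every $v$. $C^*(\Lambda)$ is the universal $C^*$-algebra of a Cuntz–Krieger $\Lambda$-family $\{s_\lambda\}$. $\Lambda^\infty$: degree-preserving functors $\Omega_k\to\Lambda$ ($\Omega_k$ has morphisms $(m,n)$, $m\le n$ in $\mathbb{N}^k$); cylinder sets $Z(\lambda)$ (infinite paths beginning with $\lambda$) generate the topology and Borel structure; standard coding maps $\sigma^n(x)(p,q)=x(p+n,q+n)$, prefixing maps $\sigma_\lambda(x)=\lambda x$ on $Z(s(\lambda))$. A $\Lambda$-projective system on $(\Lambda^\infty,\mu)$ with these maps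 means: for each $n$, $\{\sigma_\lambda: d(\lambda)=n\}$ is a semibranching function system with coding map $\sigma^n$ (in particular $0<\mu(Z(s(\lambda)))<\infty$, $\mu(Z(\lambda))<\infty$, and $d(\mu\circ\sigma_\lambda)/d\mu>0$ a.e.), together with $f_\lambda\in L^2$ satisfying $0\ne d(\mu\circ\sigma_\lambda^{-1})/d\mu=|f_\lambda|^2$ and $f_\lambda(f_\nu\circ\sigma^{d(\lambda)})=f_{\lambda\nu}$; then $T_\lambda f=f_\lambda\cdot(f\circ\sigma^{d(\lambda)})$ is a Cuntz–Krieger family. A Borel set $A\subseteq\Lambda^\infty$ of nonzero measure is $\mu$-invariant if $\mu(A\,\Delta\,(\sigma^n)^{-1}(A))=0$ for all $n\in\mathbb{N}^k$. A $\mu$-invariant $E$ is minimal $\mu$-invariant if there is no $\mu$-invariant subset $A\subseteq E$ with $\mu(A\,\Delta\,E)\ne0$. *)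

(* Defs.v *)
From HB Require Import structures.
From mathcomp Require Import all_boot all_order all_algebra.
From mathcomp Require Import all_classical all_reals all_analysis measurable_realfun.
From mathcomp Require Import complex.

Set Implicit Arguments.
Unset Strict Implicit.
Unset Printing Implicit Defensive.

Import Order.TTheory GRing.Theory Num.Theory.
Local Open Scope classical_set_scope.
Local Open Scope ring_scope.

Definition Nk (k : nat) := {ffun 'I_k -> nat}.
Definition Nk0 k : Nk k := [ffun => 0%N].
Definition addNk k (m n : Nk k) : Nk k := [ffun i => (m i + n i)%N].
Definition subNk k (m n : Nk k) : Nk k := [ffun i => (m i - n i)%N].
Definition leNk k (m n : Nk k) : bool := [forall i, (m i <= n i)%N].
Definition eNk k (i : 'I_k) : Nk k := [ffun j => nat_of_bool (j == i)].

Record kgraph (k : nat) := KGraph {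
  kvert : countType;
  kmor : countType;
  kr : kmor -> kvert;
  ks : kmor -> kvert;
  kid : kvert -> kmor;
  kcomp : kmor -> kmor -> kmor;            (* composition, meaningful when ks a = kr b *)
  kdeg : kmor -> Nk k;
  kr_id : forall v, kr (kid v) = v;
  ks_id : forall v, ks (kid v) = v;
  kr_comp : forall a b, ks a = kr b -> kr (kcomp a b) = kr a;
  ks_comp : forall a b, ks a = kr b -> ks (kcomp a b) = ks b;
  kcomp_idl : forall a, kcomp (kid (kr a)) a = a;
  kcomp_idr : forall a, kcomp a (kid (ks a)) = a;
  kcompA : forall a b c, ks a = kr b -> ks b = kr c ->
    kcomp (kcomp a b) c = kcomp a (kcomp b c);
  kdeg_id : forall v, kdeg (kid v) = Nk0 k;
  kdeg_comp : forall a b, ks a = kr b ->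
    kdeg (kcomp a b) = addNk (kdeg a) (kdeg b);
  kfactor : forall l m n, kdeg l = addNk m n ->
    exists! p : kmor * kmor,
      [/\ kdeg p.1 = m, kdeg p.2 = n, ks p.1 = kr p.2 & l = kcomp p.1 p.2]
}.

Section KGraphProps.
Variables (k : nat) (L : kgraph k).

Definition row_finite : Prop :=
  forall (v : kvert L) (n : Nk k),
    finite_set [set l : kmor L | kr l = v /\ kdeg l = n].

Definition source_free : Prop :=
  forall (v : kvert L) (n : Nk k), exists l : kmor L, kr l = v /\ kdeg l = n.

Definition no_sinks : Prop :=
  forall (i : 'I_k) (v : kvert L), exists l : kmor L, kdeg l = eNk i /\ ks l = v.

(* Infinite paths: degree-preserving functors Ω_k -> Λ.                *)

Definition Omor := {p : Nk k * Nk k | leNk p.1 p.2}.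

Definition is_ipath (x : Omor -> kmor L) : Prop :=
  [/\
      forall p : Omor, kdeg (x p) = subNk (sval p).2 (sval p).1,
      forall (m : Nk k) (h : leNk m m),
        x (exist _ (m, m) h) = kid (kr (x (exist _ (m, m) h))) &
      forall (m n p : Nk k) (h1 : leNk m n) (h2 : leNk n p) (h3 : leNk m p),
        ks (x (exist _ (m, n) h1)) = kr (x (exist _ (n, p) h2)) /\
        kcomp (x (exist _ (m, n) h1)) (x (exist _ (n, p) h2))
          = x (exist _ (m, p) h3)].

Definition ipath := {x : Omor -> kmor L | is_ipath x}.

Lemma leNk0 (n : Nk k) : leNk (Nk0 k) n.
Proof. by apply/forallP => i; rewrite ffunE. Qed.

Lemma leNkD (p q n : Nk k) : leNk p q -> leNk (addNk p n) (addNk q n).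
Proof.
by move=> /forallP h; apply/forallP => i; rewrite !ffunE leq_add2r.
Qed.

Definition ipat (x : ipath) (p q : Nk k) (h : leNk p q) : kmor L :=
  sval x (exist _ (p, q) h).

Definition iseg (x : ipath) (n : Nk k) : kmor L := ipat x (leNk0 n).

Definition cyl (l : kmor L) : set ipath := [set x | iseg x (kdeg l) = l].

Definition cylinders : set (set ipath) := [set cyl l | l in [set: kmor L]].

Definition shift_fun (n : Nk k) (x : ipath) : Omor -> kmor L :=
  fun pq => sval x (exist _ (addNk (sval pq).1 n, addNk (sval pq).2 n)
                          (leNkD n (svalP pq))).

Lemma shift_ipath (n : Nk k) (x : ipath) : is_ipath (shift_fun n x).
Proof.
case: x => x [hd hi hc]; split.
- move=> [[p q] h] /=; rewrite /shift_fun /= hd /=.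
  by apply/ffunP => i; rewrite !ffunE subnDr.
- move=> m h; rewrite /shift_fun /=; exact: hi.
- move=> m n' p h1 h2 h3; rewrite /shift_fun /=; exact: hc.
Qed.

Definition shift (n : Nk k) (x : ipath) : ipath :=
  exist _ (shift_fun n x) (shift_ipath n x).

Definition kopen (U : set ipath) : Prop :=
  forall x, U x -> exists l : kmor L, cyl l x /\ cyl l `<=` U.

Definition kcompact (K : set ipath) : Prop :=
  forall (I : Type) (U : I -> set ipath),
    (forall i, kopen (U i)) -> K `<=` \bigcup_i U i ->
    exists F : set I, finite_set F /\ K `<=` \bigcup_(i in F) U i.

End KGraphProps.

(* A point of Λ^∞ is needed to build a measurable type (mathcomp-analysis
   measurable types are pointed). *)
Definition ipathp k (L : kgraph k) (x0 : ipath L) := ipath L.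
HB.instance Definition _ k (L : kgraph k) (x0 : ipath L) :=
  gen_eqMixin (ipathp x0).
HB.instance Definition _ k (L : kgraph k) (x0 : ipath L) :=
  gen_choiceMixin (ipathp x0).
HB.instance Definition _ k (L : kgraph k) (x0 : ipath L) :=
  isPointed.Build (ipathp x0) x0.

Definition IPS k (L : kgraph k) (x0 : ipath L) : Type := ipathp x0.
HB.instance Definition _ k (L : kgraph k) (x0 : ipath L) :=
  Pointed.on (IPS x0).
HB.instance Definition _ k (L : kgraph k) (x0 : ipath L) :=
  Measurable.copy (IPS x0)
    (g_sigma_algebraType (@cylinders k L : set (set (ipathp x0)))).

Section Measures.
Variables (k : nat) (L : kgraph k) (x0 : ipath L) (R : realType).
Local Notation X := (IPS x0).
Local Notation C := (complex R).
Variable mu : {measure set X -> \bar R}.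

Definition Z (l : kmor L) : set X := cyl l.
Definition sig (n : Nk k) : X -> X := shift n.

(* prefixing map σ_λ(y) = λy on Z(s(λ)): the unique path x in Z(λ) with
   σ^{d(λ)}(x) = y *)
Definition prefix (l : kmor L) (y : X) : X :=
  xget (x0 : X) [set x : X | Z l x /\ sig (kdeg l) x = y].

(* Radon measure (Folland): finite on compact sets, outer regular on Borel
   sets, inner regular on open sets, for the cylinder topology. *)
Definition radon : Prop :=
  [/\ forall K : set X, kcompact K -> (mu K < +oo)%E,
      forall A : set X, measurable A ->
        mu A = ereal_inf [set mu U | U in [set U : set X | kopen U /\ A `<=` U]] &
      forall U : set X, kopen U ->
        mu U = ereal_sup [set mu K | K in [set K : set X | kcompact K /\ K `<=` U]]].

Definition is_RN_deriv (nu : set X -> \bar R) (D : set X) (Phi : X -> \bar R) :=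
  [/\ measurable_fun D Phi, forall x, D x -> (0 <= Phi x)%E &
      forall A, measurable A -> A `<=` D -> nu A = (\int[mu]_(x in A) Phi x)%E].

Definition cmeas (f : X -> C) : Prop :=
  measurable_fun setT (fun x => complex.Re (f x)) /\ measurable_fun setT (fun x => complex.Im (f x)).

Definition csq (z : C) : R := complex.Re z ^+ 2 + complex.Im z ^+ 2.

Definition L2 (f : X -> C) : Prop :=
  cmeas f /\ (\int[mu]_x (csq (f x))%:E < +oo)%E.

Definition L2on (E : set X) (f : X -> C) : Prop :=
  L2 f /\ {ae mu, forall x, ~ E x -> f x = 0}.

Definition cinner (f g : X -> C) : C :=
  Complex (Rintegral mu setT (fun x => complex.Re (f x * conjc (g x))))
          (Rintegral mu setT (fun x => complex.Im (f x * conjc (g x)))).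

(* The family {σ_λ : d(λ) = n} is a semibranching function system with
   coding map σ^n (domains D_λ = Z(s λ), ranges R_λ = Z(λ)). *)
Definition semibranching (n : Nk k) : Prop :=
  [/\ measurable_fun setT (sig n),
      forall l, kdeg l = n ->
        [/\ measurable_fun (Z (kid (ks l))) (prefix l),
            (0 < mu (Z (kid (ks l))))%E, (mu (Z (kid (ks l))) < +oo)%E,
            (mu (Z l) < +oo)%E &
            forall y, Z (kid (ks l)) y -> sig n (prefix l y) = y],
      mu (~` \bigcup_(l in [set l | kdeg l = n]) (prefix l @` Z (kid (ks l)))) = 0%E,
      forall l l', kdeg l = n -> kdeg l' = n -> l <> l' ->
        mu (prefix l @` Z (kid (ks l)) `&` prefix l' @` Z (kid (ks l'))) = 0%E &
      forall l, kdeg l = n ->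
        exists Phi, is_RN_deriv (fun A => mu (prefix l @` A)) (Z (kid (ks l))) Phi
          /\ {ae mu, forall x, Z (kid (ks l)) x -> (0 < Phi x)%E}].

Definition Top (f : kmor L -> X -> C) (l : kmor L) (g : X -> C) : X -> C :=
  fun x => f l x * g (sig (kdeg l) x).

Definition projective_system (f : kmor L -> X -> C) : Prop :=
  [/\ forall n, semibranching n,
      forall l, L2 (f l),
      forall l, ~ {ae mu, forall x, f l x = 0},
      forall l, is_RN_deriv
                  (fun A => mu (Z (kid (ks l)) `&` prefix l @^-1` A)) setT
                  (fun x => (csq (f l x))%:E) &
      forall l l', ks l = kr l' ->
        {ae mu, forall x, f l x * f l' (sig (kdeg l) x) = f (kcomp l l') x}].

Definition symdiff (A B : set X) : set X := (A `\` B) `|` (B `\` A).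

Definition mu_invariant (A : set X) : Prop :=
  [/\ measurable A, mu A <> 0%E &
      forall n : Nk k, mu (symdiff A (sig n @^-1` A)) = 0%E].

Definition minimal_mu_invariant (E : set X) : Prop :=
  mu_invariant E /\
  ~ exists A, [/\ mu_invariant A, A `<=` E & mu (symdiff A E) <> 0%E].

(* closed subspaces of L^2(E, mu) (as sets of functions, closed under
   a.e. equality) *)
Definition closed_subspace (E : set X) (M : set (X -> C)) : Prop :=
  [/\ M `<=` L2on E, M (fun _ => 0),
      (forall f g, M f -> M g -> M (fun x => f x + g x)) /\
      forall (c : C) f, M f -> M (fun x => c * f x),
      forall f g, M f -> L2on E g -> {ae mu, forall x, f x = g x} -> M g &
      forall (u : nat -> X -> C) g, (forall m, M (u m)) -> L2on E g ->
        (fun m => (\int[mu]_x (csq (u m x - g x))%:E)%E) @ \oo --> 0%E -> M g].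

(* M is invariant under T_λ and under the adjoint of T_λ restricted to
   L^2(E, mu), for all λ, i.e. under the image of C^*(Λ). *)
Definition reducing (f : kmor L -> X -> C) (E : set X) (M : set (X -> C)) :=
  forall l,
    (forall g, M g -> M (Top f l g)) /\
    (forall g, M g -> exists h, M h /\
        forall g', L2on E g' -> cinner (Top f l g') g = cinner g' h).

Definition irreducible_restriction (f : kmor L -> X -> C) (E : set X) : Prop :=
  [/\
      forall l g, L2on E g -> L2on E (Top f l g),
      forall l g, L2on E g -> exists h, L2on E h /\
        forall g', L2 g' -> cinner (Top f l g') g = cinner g' h,
      exists g, L2on E g /\ ~ {ae mu, forall x, g x = 0} &
      forall M, closed_subspace E M -> reducing f E M ->
        M = [set g | L2on E g /\ {ae mu, forall x, g x = 0}] \/ M = L2on E].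

End Measures.

(* Main.v *)
(* For a path l, the adjoint of T_l is h |-> 1_{Z(s(l))} (h / f_l) o sigma_l, and T_l T_l^* is
   multiplication by the indicator of Z(l).  Hence a closed reducing subspace M of L^2(E) is stable
   under multiplication by indicators of cylinders, so of all Borel sets, and by simple
   approximation it contains every function of L^2(E) carried by the support S of any of its
   members g.  The Borel sets with this property ("filled" by M) are stable under countable unions,
   under preimages by sigma^n (because h = T_l T_l^* h on Z(l)) and under images by sigma^n
   (because h = T_l^* T_l h on Z(s(l))); so M fills the set B of all x with sigma^m x = sigma^n s
   for some m, n and some s in S.  This B satisfies sigma^-n B = B exactly, so the intersection of
   E and B is invariant, and not null when g is not 0; by minimality it is E, and M = L^2(E). *)
Require Import Defs.
From HB Require Import structures.
From mathcomp Require Import all_boot all_order all_algebra.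
From mathcomp Require Import all_classical all_reals all_analysis measurable_realfun.
From mathcomp Require Import complex.
From mathcomp Require Import ring lra.
(* [ks] and other names of [Defs] are shadowed by mathcomp-analysis. *)
Import Defs.

Set Implicit Arguments.
Unset Strict Implicit.
Unset Printing Implicit Defensive.

Import Order.TTheory GRing.Theory Num.Theory.
Import numFieldNormedType.Exports.
Local Open Scope classical_set_scope.
Local Open Scope ring_scope.
Local Open Scope complex_scope.

(** * Infinite paths are determined by, and built from, their initial segments *)

Section InfinitePaths.
Variables (k : nat) (L : kgraph k).
Implicit Types (x y : ipath L) (l : kmor L) (m n p q : Nk k).

Lemma ipath_eq x y : sval x = sval y -> x = y.
Proof. exact/eq_sig_hprop/(fun=> @Prop_irrelevance _). Qed.

(** The proof of [leNk] depends on both indices, so equal indices have to be exchanged together with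
    it. *)
Lemma ipat_congr x p q p' q' (h : leNk p q) (h' : leNk p' q') :
  p = p' -> q = q' -> ipat x h = ipat x h'.
Proof.
move=> pp' qq'; rewrite /ipat; congr (sval x _).
by apply: eq_exist => /=; rewrite pp' qq'.
Qed.

Lemma leNk_addr n m : leNk n (addNk n m).
Proof. by apply/forallP => i; rewrite ffunE leq_addr. Qed.

Lemma leNk_addl n m : leNk n (addNk m n).
Proof. by apply/forallP => i; rewrite ffunE leq_addl. Qed.

Lemma kdeg_iseg x n : kdeg (iseg x n) = n.
Proof.
case: (svalP x) => hd _ _; rewrite /iseg /ipat hd /=.
by apply/ffunP => i; rewrite !ffunE subn0.
Qed.

Lemma kdeg_ipat x p q (h : leNk p q) : kdeg (ipat x h) = subNk q p.
Proof. by case: (svalP x) => hd _ _; rewrite /ipat hd. Qed.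

Lemma iseg_comp x p q (h : leNk p q) :
  ks (iseg x p) = kr (ipat x h) /\ iseg x q = kcomp (iseg x p) (ipat x h).
Proof.
case: (svalP x) => _ _ hc.
by have [-> ->] := hc _ _ _ (leNk0 p) h (leNk0 q).
Qed.

(** The uniqueness half of the factorization property, in the form of a cancellation rule for
    factors of matching degrees. *)
Lemma kcomp_inj (a a' b b' : kmor L) : kdeg a = kdeg a' -> kdeg b = kdeg b' ->
  ks a = kr b -> ks a' = kr b' -> kcomp a b = kcomp a' b' -> a = a' /\ b = b'.
Proof.
move=> da db hab hab' e.
have [u [_ hu]] := kfactor (kdeg_comp hab).
have e1 := hu (a, b) (And4 erefl erefl hab erefl).
have := hu (a', b') (And4 (esym da) (esym db) hab' e).
by rewrite e1; case=> -> ->.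
Qed.

Lemma iseg_ipat_inj x y p q (h : leNk p q) : iseg x q = iseg y q ->
  iseg x p = iseg y p /\ ipat x h = ipat y h.
Proof.
have [sx ->] := iseg_comp x h; have [sy ->] := iseg_comp y h.
by apply: kcomp_inj; rewrite ?kdeg_iseg ?kdeg_ipat.
Qed.

(** Each segment x(p,q) is a factor of x(0,q), so unique factorization recovers it from the initial
    segments. *)
Lemma iseg_inj x y : (forall n, iseg x n = iseg y n) -> x = y.
Proof.
move=> e; apply/ipath_eq/funext => -[[p q] h].
by have [_] := iseg_ipat_inj h (e q).
Qed.

Lemma iseg_shift x n m : iseg (shift n x) m = ipat x (leNk_addl n m).
Proof.
rewrite /iseg {1}/ipat /= /shift_fun /=; apply: ipat_congr => //=.
by apply/ffunP => i; rewrite !ffunE.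
Qed.

(** The initial segment of degree n + d(l) is [l] followed by a segment of the shifted path; its
    factor of degree n is then determined. *)
Lemma cyl_shift_inj l x y : cyl l x -> cyl l y ->
  shift (kdeg l) x = shift (kdeg l) y -> x = y.
Proof.
move=> lx ly e; apply: iseg_inj => n.
suff : iseg x (addNk n (kdeg l)) = iseg y (addNk n (kdeg l)).
  by case/(iseg_ipat_inj (leNk_addr n (kdeg l))).
have [_ ->] := iseg_comp x (leNk_addl (kdeg l) n).
have [_ ->] := iseg_comp y (leNk_addl (kdeg l) n).
by rewrite lx ly -!iseg_shift e.
Qed.

Lemma cyl_iseg x n : cyl (iseg x n) x.
Proof. by rewrite /cyl /= kdeg_iseg. Qed.

Lemma iseg0 x : iseg x (Nk0 k) = kid (kr (iseg x (Nk0 k))).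
Proof. by case: (svalP x) => _ hi _; rewrite {1}/iseg /ipat hi. Qed.

Lemma cyl_id_shift l x : cyl l x -> cyl (kid (ks l)) (shift (kdeg l) x).
Proof.
move=> lx; rewrite /cyl /mkset kdeg_id iseg0; congr kid.
by rewrite iseg_shift -(iseg_comp x _).1 lx.
Qed.

Lemma shiftD n m x : shift n (shift m x) = shift (addNk n m) x.
Proof.
apply/ipath_eq/funext => -[[p q] h]; rewrite /= /shift_fun /=.
congr (sval x _); apply: eq_exist => /=.
by congr pair; apply/ffunP => i; rewrite !ffunE addnA.
Qed.

Lemma addNkC n m : addNk n m = addNk m n.
Proof. by apply/ffunP => i; rewrite !ffunE addnC. Qed.

Lemma kdeg_factor (u : kmor L) p q : kdeg u = addNk p q ->
  exists a b, [/\ kdeg a = p, kdeg b = q, ks a = kr b & u = kcomp a b].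
Proof. by move=> /kfactor[[a b] [[? ? ? ?] _]]; exists a, b. Qed.

(** The segment from [p] to [q] is the path by which [h q] extends [h p]; uniqueness of
    factorization makes these segments a functor. *)
Lemma ipath_of_prefixes (h : Nk k -> kmor L) : (forall n, kdeg (h n) = n) ->
  (forall p q, leNk p q -> exists c, ks (h p) = kr c /\ h q = kcomp (h p) c) ->
  exists x, forall n, iseg x n = h n.
Proof.
move=> dh hh.
have /choice[g hg] : forall pq : Omor k, exists c,
    ks (h (sval pq).1) = kr c /\ h (sval pq).2 = kcomp (h (sval pq).1) c.
  by move=> [[p q] pq]; exact: hh.
have dg pq : kdeg (g pq) = subNk (sval pq).2 (sval pq).1.
  have [s e] := hg pq; have := congr1 (@kdeg _ _) e.
  rewrite (kdeg_comp s) !dh => ->.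
  by apply/ffunP => i; rewrite !ffunE addKn.
have gP : is_ipath g.
  (* Both functor laws compare two factorizations: of [h m] as itself followed by an identity, and
     of [h p] through [h m] directly or by way of [h n]. *)
  split=> // [m mm|m n p mn np mp].
    have [/= s e] := hg (exist _ (m, m) mm).
    have := etrans (kcomp_idr (h m)) e => /kcomp_inj[]//.
    - rewrite kdeg_id dg; apply/ffunP => i; rewrite !ffunE subnn//.
    - by rewrite kr_id.
    - by move=> _ <-; rewrite kr_id.
  have [/= s1 e1] := hg (exist _ (m, n) mn).
  have [/= s2 e2] := hg (exist _ (n, p) np).
  have [/= s3 e3] := hg (exist _ (m, p) mp).
  have s12 : ks (g (exist _ (m, n) mn)) = kr (g (exist _ (n, p) np)).
    by rewrite -s2 e1 ks_comp.
  split=> //; move: e3; rewrite {1}e2 {1}e1 kcompA// => /kcomp_inj[]//.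
  - rewrite kdeg_comp// !dg /=; apply/ffunP => i; rewrite !ffunE.
    have /forallP/(_ i) mni := mn; have /forallP/(_ i) npi := np.
    by rewrite addnC addnBA// subnK.
  - by rewrite kr_comp.
exists (exist _ g gP) => n.
have [/= s e] := hg (exist _ (Nk0 k, n) (leNk0 n)).
have := etrans (kcomp_idl (h n)) e => /kcomp_inj[]//.
- by rewrite kdeg_id dh.
- by rewrite dh dg; apply/ffunP => i; rewrite !ffunE subn0.
- by rewrite ks_id.
Qed.

Lemma cyl_id_source l y n : cyl (kid (ks l)) y -> ks l = kr (iseg y n).
Proof.
rewrite /cyl /mkset kdeg_id => y0.
have [s ->] := iseg_comp y (leNk0 n).
by rewrite kr_comp// y0 kr_id.
Qed.

(** In degree n the path l y has to begin with the factor of degree n of l y(0,n). This product has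
    degree n + d(l), so the factor exists, and [ipath_of_prefixes] assembles the factors. *)
Lemma cyl_prefix l y : cyl (kid (ks l)) y ->
  exists x, cyl l x /\ shift (kdeg l) x = y.
Proof.
move=> yl; have sl n := cyl_id_source n yl.
have dw n : kdeg (kcomp l (iseg y n)) = addNk n (kdeg l).
  by rewrite kdeg_comp// kdeg_iseg addNkC.
have /choice[h hh] n : exists a, exists b,
    [/\ kdeg a = n, kdeg b = kdeg l, ks a = kr b & kcomp l (iseg y n) = kcomp a b].
  exact/kdeg_factor/dw.
have dh n : kdeg (h n) = n by case: (hh n) => b [].
have wE p q (pq : leNk p q) :
    kcomp l (iseg y q) = kcomp (kcomp l (iseg y p)) (ipat y pq).
  by have [s ->] := iseg_comp y pq; rewrite kcompA.
have sw p q (pq : leNk p q) : ks (kcomp l (iseg y p)) = kr (ipat y pq).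
  by rewrite ks_comp//; have [] := iseg_comp y pq.
have /ipath_of_prefixes[//|x xh] : forall p q, leNk p q ->
    exists c, ks (h p) = kr c /\ h q = kcomp (h p) c.
  move=> p q pq; have [b [_ db sb eb]] := hh p; have [c [_ dc sc ec]] := hh q.
  (* [a] is the factor of degree [p] of [h q]. Both [a] and [h p] are initial factors of l y(0,q),
     so they coincide. *)
  have [a [t [da dt sat et]]] : exists a t, [/\ kdeg a = p, kdeg t = subNk q p,
      ks a = kr t & h q = kcomp a t].
    apply: kdeg_factor; rewrite dh; apply/ffunP => i; rewrite !ffunE subnKC//.
    by move/forallP : pq.
  suff <- : a = h p by exists t.
  have tc : ks t = kr c by rewrite -sc et ks_comp.
  have bi : ks b = kr (ipat y pq) by rewrite -(sw p q) eb ks_comp.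
  have := wE p q pq; rewrite ec eb et !kcompA// => /kcomp_inj[]//.
  - by rewrite da dh.
  - by rewrite !kdeg_comp// dt dc db kdeg_ipat addNkC.
  - by rewrite kr_comp.
  - by rewrite kr_comp.
(* The left side was cut from l y(0, n + d(l)), which also begins with l y(0,n), a path of the same
   degree. *)
have hE n : h (addNk n (kdeg l)) = kcomp l (iseg y n).
  have [b [_ db sb]] := hh (addNk n (kdeg l)).
  rewrite (wE n _ (leNk_addr _ _)) => /esym/kcomp_inj[]//.
  - by rewrite dh dw.
  - rewrite db kdeg_ipat; apply/ffunP => i; rewrite !ffunE addKn//.
have xl : cyl l x.
  rewrite /cyl /mkset xh; have := hE (Nk0 k).
  rewrite (_ : addNk _ _ = kdeg l); last by apply/ffunP => i; rewrite !ffunE.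
  move: yl; rewrite /cyl /mkset kdeg_id => -> ->.
  exact: kcomp_idr.
exists x; split=> //; apply: iseg_inj => n.
rewrite iseg_shift.
have [s e] := iseg_comp x (leNk_addl (kdeg l) n).
move: e; rewrite xh hE => /kcomp_inj[]//.
- by rewrite kdeg_iseg.
- rewrite kdeg_iseg kdeg_ipat; apply/ffunP => i; rewrite !ffunE addnK//.
Qed.

End InfinitePaths.

(** * The squared modulus of a complex number *)

Section ComplexSquare.
Variable R : realType.
Implicit Types z w : complex R.

Lemma csq_ge0 z : 0 <= csq z.
Proof. by rewrite addr_ge0 ?sqr_ge0. Qed.

Lemma csqM z w : csq (z * w) = csq z * csq w.
Proof. by case: z w => [a b] [c d]; rewrite /csq /=; ring. Qed.

Lemma csq0 : csq (0 : complex R) = 0.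
Proof. by rewrite /csq /= expr0n /= addr0. Qed.

Lemma csqN z : csq (- z) = csq z.
Proof. by case: z => a b; rewrite /csq /= !sqrrN. Qed.

Lemma csq_real (r : R) : csq r%:C = r ^+ 2.
Proof. by rewrite /csq /= expr0n /= addr0. Qed.

Lemma csq_eq0 z : (csq z == 0) = (z == 0).
Proof.
case: z => a b; rewrite /csq /= paddr_eq0 ?sqr_ge0//.
by rewrite !sqrf_eq0 eq_complex.
Qed.

Lemma csqV z : csq z^-1 = (csq z)^-1.
Proof.
have [->|z0] := eqVneq z 0; first by rewrite invr0 csq0 invr0.
have c0 : csq z != 0 by rewrite csq_eq0.
by apply: (mulfI c0); rewrite -csqM !divff// csq_real expr1n.
Qed.

(** By the parallelogram law the two sides differ by |z - w|^2. *)
Lemma csqD_le z w : csq (z + w) <= 2 * csq z + 2 * csq w.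
Proof.
case: z w => [a b] [c d]; rewrite /csq /= -subr_ge0.
have -> : 2 * (a ^+ 2 + b ^+ 2) + 2 * (c ^+ 2 + d ^+ 2) -
    ((a + c) ^+ 2 + (b + d) ^+ 2) = (a - c) ^+ 2 + (b - d) ^+ 2 by ring.
by rewrite addr_ge0 ?sqr_ge0.
Qed.

Lemma csqE z : (csq z)%:C = z * conjc z.
Proof.
case: z => a b; apply/eqP; rewrite eq_complex /csq /=.
by apply/andP; split; apply/eqP; ring.
Qed.

Lemma Re_realM (r : R) z : complex.Re (r%:C * z) = r * complex.Re z.
Proof. by case: z => a b /=; rewrite mul0r subr0. Qed.

Lemma Im_realM (r : R) z : complex.Im (r%:C * z) = r * complex.Im z.
Proof. by case: z => a b /=; rewrite mul0r addr0. Qed.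

(* With [x / 0 = 0] this holds at [z = 0] as well. *)
Lemma mul_conj_div z w u : z * w * conjc u = (csq z)%:C * (w * conjc (u / z)).
Proof.
have [->|z0] := eqVneq z 0; first by rewrite csq0 !mul0r.
rewrite rmorphM /= conjc_inv csqE.
have c0 : conjc z != 0 by rewrite conjc_eq0.
by field.
Qed.

End ComplexSquare.

(** * Change of variables *)

Section ImageDensity.
Local Open Scope ereal_scope.
Context d (T : measurableType d) (R : realType).
Variables (mu : {measure set T -> \bar R}) (D : set T) (p : T -> T).
Variable w : T -> R.
Hypotheses (mD : measurable D) (mp : measurable_fun D p).
Hypotheses (mw : measurable_fun setT w) (w0 : forall x, (0 <= w x)%R).
(** [w] is the density, with respect to [mu], of the push-forward under [p] of the restriction of
    [mu] to [D]. *)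
Hypothesis pw : forall A, measurable A ->
  mu (D `&` p @^-1` A) = \int[mu]_(x in A) (w x)%:E.

Import HBNNSimple.

(** Split by the values of [h]: on each level set the formula is [pw]. *)
Lemma ge0_integral_image_nnsfun (h : {nnsfun T >-> R}) :
  \int[mu]_x ((h x * w x)%R)%:E = \int[mu]_(y in D) (h (p y))%:E.
Proof.
have hE x : (h x)%:E = \sum_(r \in range h) (r * \1_(h @^-1` [set r]) x)%:E.
  by rewrite {1}fimfunE -fsumEFin.
have hr0 r x : 0 <= (r * \1_(h @^-1` [set r]) x)%:E.
  by rewrite EFinM; exact: nnfun_muleindic_ge0.
transitivity (\sum_(r \in range h) r%:E * mu (D `&` p @^-1` (h @^-1` [set r]))).
  under eq_integral => x _.
    rewrite EFinM hE ge0_mule_fsuml => [|r]; last exact: hr0.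
    over.
  rewrite ge0_integral_fsum//; last 2 first.
  - move=> r; apply: emeasurable_funM; last exact/measurable_EFinP.
    exact/measurable_EFinP/measurable_funM.
  - by move=> r x _; rewrite mule_ge0 ?hr0 ?lee_fin.
  apply: eq_fsbigr => r; rewrite inE => -[y _ hy].
  rewrite pw// (integral_mkcond (h @^-1` _)) -ge0_integralZl//; last 3 first.
  - by apply/(measurable_restrictT _ _).1 => //; apply: measurable_funTS; apply/measurable_EFinP.
  - by move=> x _; rewrite patchE; case: ifP => _ //; rewrite lee_fin.
  - by rewrite lee_fin -hy.
  apply: eq_integral => x _; rewrite EFinM -muleA epatch_indic; congr (_ * _).
  exact: muleC.
symmetry; under eq_integral do rewrite hE.
rewrite ge0_integral_fsum//; last first.
  move=> r; apply/measurable_EFinP/measurable_funM => //.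
  by apply: measurableT_comp.
apply: eq_fsbigr => r; rewrite inE => -[y _ hy].
under eq_integral do rewrite EFinM.
rewrite ge0_integralZl//; last 2 first.
- by apply/measurable_EFinP; apply: measurableT_comp.
- by rewrite lee_fin -hy.
congr (_ * _).
have : measurable (D `&` p @^-1` (h @^-1` [set r])) by apply: mp.
move: (h @^-1` [set r]) => B mDB.
rewrite -[D in D `&` _](setIid D) setIAC -integral_indic//.
apply: eq_integral => x /set_mem Dx; rewrite !indicE in_setI (mem_set Dx)/=.
by congr (_%:R)%:E; apply: congr1; apply/idP/idP => /set_mem ?; exact/mem_set.
Qed.

(** Simple functions increase to [f], and monotone convergence applies on both sides. *)
Lemma ge0_integral_image (f : T -> R) :
  measurable_fun setT f -> (forall x, (0 <= f x)%R) ->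
  \int[mu]_x ((f x * w x)%R)%:E = \int[mu]_(y in D) (f (p y))%:E.
Proof.
move=> mf f0.
have mEf : measurable_fun setT (EFin \o f) by exact/measurable_EFinP.
pose h := nnsfun_approx measurableT mEf.
have hcvg x : (h n x)%:E @[n --> \oo] --> (f x)%:E.
  by apply: (cvg_nnsfun_approx measurableT mEf) => // y _; rewrite lee_fin.
have hnd x : nondecreasing_seq (h ^~ x).
  by move=> m n mn; exact/lefP/nd_nnsfun_approx.
transitivity (limn (fun n => \int[mu]_x ((h n x * w x)%R)%:E)).
  rewrite -monotone_convergence//.
  - apply: eq_integral => x _; apply/esym/cvg_lim => //.
    under eq_fun do rewrite EFinM.
    by rewrite EFinM; apply: cvgeZr.
  - move=> n; apply/measurable_EFinP/measurable_funM => //.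
  - by move=> n x _; rewrite lee_fin mulr_ge0.
  - by move=> x _ m n mn; rewrite lee_fin ler_wpM2r//; exact: hnd.
under eq_fun do rewrite ge0_integral_image_nnsfun.
rewrite -monotone_convergence//.
- by apply: eq_integral => x _; exact/cvg_lim.
- by move=> n; apply/measurable_EFinP; apply: measurableT_comp.
- by move=> n x _; rewrite lee_fin.
- by move=> x _ m n mn; rewrite lee_fin; exact: hnd.
Qed.

(** As [w] is nonnegative, it passes into the positive and negative parts. These are transported
    separately, so [fine] is applied to the same extended real on both sides, whether or not it is
    finite. *)
Lemma Rintegral_image (f : T -> R) : measurable_fun setT f ->
  (\int[mu]_x (f x * w x) = \int[mu]_(y in D) f (p y))%R.
Proof.
move=> mf; rewrite /Rintegral; congr fine.
rewrite integralE [RHS]integralE; congr (_ - _).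
  transitivity (\int[mu]_x ((f^\+ x * w x)%R)%:E).
    by apply: eq_integral => x _; rewrite funeposE /funrpos -EFin_max maxr_pMl// mul0r.
  rewrite ge0_integral_image//; last exact: measurable_funrpos.
  by apply: eq_integral => x _; rewrite funeposE /funrpos -EFin_max.
transitivity (\int[mu]_x ((f^\- x * w x)%R)%:E).
  by apply: eq_integral => x _; rewrite funenegE /funrneg -EFinN -EFin_max maxr_pMl// mul0r mulNr.
rewrite ge0_integral_image//; last exact: measurable_funrneg.
by apply: eq_integral => x _; rewrite funenegE /funrneg -EFinN -EFin_max.
Qed.

End ImageDensity.

(** * Measurability and square-integrability of complex functions *)

Section SquareIntegrable.
Variables (k : nat) (L : kgraph k) (x0 : ipath L) (R : realType).
Local Notation X := (IPS x0).
Local Notation C := (complex R).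
Variable mu : {measure set X -> \bar R}.
Implicit Types (f g h : X -> C) (A B E : set X) (r : X -> R).

Lemma measurable_cyl (l : kmor L) : measurable (Z l : set X).
Proof. by apply: sub_sigma_algebra; exists l. Qed.

Lemma cmeas_cst (c : C) : cmeas (fun _ : X => c).
Proof. by split; exact: measurable_cst. Qed.

Lemma cmeasD f g : cmeas f -> cmeas g -> cmeas (fun x => f x + g x).
Proof.
move=> [fr fi] [gr gi]; split.
- rewrite [X in measurable_fun _ X](_ : _ =
    (fun x => complex.Re (f x)) \+ (fun x => complex.Re (g x))).
    exact: measurable_funD.
  by apply/funext => x /=; case: (f x) (g x) => [? ?] [].
- rewrite [X in measurable_fun _ X](_ : _ =
    (fun x => complex.Im (f x)) \+ (fun x => complex.Im (g x))).
    exact: measurable_funD.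
  by apply/funext => x /=; case: (f x) (g x) => [? ?] [].
Qed.

Lemma cmeasM f g : cmeas f -> cmeas g -> cmeas (fun x => f x * g x).
Proof.
move=> [fr fi] [gr gi]; split.
- rewrite [X in measurable_fun _ X](_ : _ =
    ((fun x => complex.Re (f x)) \* (fun x => complex.Re (g x))) \-
    ((fun x => complex.Im (f x)) \* (fun x => complex.Im (g x)))).
    by apply: measurable_funB; exact: measurable_funM.
  by apply/funext => x /=; case: (f x) (g x) => [? ?] [].
- rewrite [X in measurable_fun _ X](_ : _ =
    ((fun x => complex.Re (f x)) \* (fun x => complex.Im (g x))) \+
    ((fun x => complex.Im (f x)) \* (fun x => complex.Re (g x)))).
    by apply: measurable_funD; exact: measurable_funM.
  by apply/funext => x /=; case: (f x) (g x) => [? ?] [].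
Qed.

Lemma cmeasN f : cmeas f -> cmeas (fun x => - f x).
Proof.
move=> mf; rewrite (_ : (fun x => _) = fun x => (- 1) * f x).
  by apply: cmeasM => //; exact: cmeas_cst.
by apply/funext => x; rewrite mulN1r.
Qed.

Lemma cmeas_real r : measurable_fun setT r -> cmeas (fun x => (r x)%:C).
Proof. by split=> //=; exact: measurable_cst. Qed.

Lemma cmeas_comp f (p : X -> X) : measurable_fun setT p -> cmeas f ->
  cmeas (fun x => f (p x)).
Proof.
by move=> mp [fr fi]; split;
  [exact: (measurableT_comp fr)|exact: (measurableT_comp fi)].
Qed.

Lemma measurable_csq f : cmeas f -> measurable_fun setT (fun x => csq (f x)).
Proof. by move=> [fr fi]; apply: measurable_funD; exact: measurable_funX. Qed.

Lemma cmeas_conj f : cmeas f -> cmeas (fun x => conjc (f x)).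
Proof.
move=> [fr fi]; split.
- by rewrite [X in measurable_fun _ X](_ : _ = fun x => complex.Re (f x))//;
    apply/funext => x; case: (f x).
- rewrite [X in measurable_fun _ X](_ : _ = \- (fun x => complex.Im (f x))).
    exact: measurable_funN.
  by apply/funext => x /=; case: (f x).
Qed.

Lemma cmeasV f : cmeas f -> cmeas (fun x => (f x)^-1).
Proof.
(* The inverse of z is |z|^-2 times its conjugate, and real powers are measurable; at z = 0 both
   sides are 0. *)
move=> mf; rewrite (_ : (fun x => _) =
    fun x => ((csq (f x)) `^ (-1))%:C * conjc (f x)).
  apply: cmeasM; last exact: cmeas_conj.
  apply: cmeas_real.
  exact: (measurableT_comp (@measurable_powR R (-1)) (measurable_csq mf)).
apply/funext => x; rewrite powR_inv1 ?csq_ge0//.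
have [->|f0] := eqVneq (f x) 0; first by rewrite invr0 conjc0 mulr0.
apply: (mulfI f0); rewrite mulfV// mulrCA -csqE.
by rewrite -rmorphM /= mulVf// csq_eq0.
Qed.

Lemma measurable_csqE f : cmeas f ->
  measurable_fun setT (fun x => (csq (f x))%:E).
Proof. by move=> mf; apply/measurable_EFinP; exact: measurable_csq. Qed.

Lemma measurable_eq0 f : cmeas f -> measurable [set x | f x = 0].
Proof.
move=> mf; rewrite (_ : [set _ | _] = (fun x => csq (f x)) @^-1` [set 0]).
  by rewrite -[_ @^-1` _]setTI; exact: measurable_csq.
apply/seteqP; split => x /=; first by move=> ->; exact: csq0.
by move/eqP; rewrite csq_eq0 => /eqP.
Qed.

Lemma L2_le (c : R) f g : cmeas f -> L2 mu g -> 0 <= c ->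
  (forall x, csq (f x) <= c * csq (g x)) -> L2 mu f.
Proof.
move=> mf [mg g2] c0 fg; split=> //.
apply: (@le_lt_trans _ _ (c%:E * \int[mu]_x (csq (g x))%:E)%E); last first.
  by apply: lte_mul_pinfty.
rewrite -ge0_integralZl//; last 2 first.
- exact: measurable_csqE.
- by move=> x _; rewrite lee_fin csq_ge0.
apply: ge0_le_integral => //.
- by move=> x _; rewrite lee_fin csq_ge0.
- exact: measurable_csqE.
- by apply/measurable_EFinP/measurable_funM => //; exact: measurable_csq.
- by move=> x _; rewrite -EFinM lee_fin.
Qed.

Lemma L2D f g : L2 mu f -> L2 mu g -> L2 mu (fun x => f x + g x).
Proof.
move=> [mf f2] [mg g2]; split; first exact: cmeasD.
apply: (@le_lt_trans _ _ (\int[mu]_x ((2 * csq (f x))%:E + (2 * csq (g x))%:E))%E).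
  apply: ge0_le_integral => //.
  - by move=> x _; rewrite lee_fin csq_ge0.
  - by apply: measurable_csqE; exact: cmeasD.
  - apply/measurable_EFinP/measurable_funD; apply: measurable_funM => //;
      exact: measurable_csq.
  - by move=> x _; rewrite -EFinD lee_fin csqD_le.
rewrite ge0_integralD//; last 4 first.
- by move=> x _; rewrite lee_fin mulr_ge0// csq_ge0.
- by apply/measurable_EFinP/measurable_funM => //; exact: measurable_csq.
- by move=> x _; rewrite lee_fin mulr_ge0// csq_ge0.
- by apply/measurable_EFinP/measurable_funM => //; exact: measurable_csq.
under eq_integral do rewrite EFinM.
under [X in (_ + X)%E]eq_integral do rewrite EFinM.
rewrite !ge0_integralZl//; last 4 first.
- exact: measurable_csqE.
- by move=> x _; rewrite lee_fin csq_ge0.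
- exact: measurable_csqE.
- by move=> x _; rewrite lee_fin csq_ge0.
by apply: lte_add_pinfty; apply: lte_mul_pinfty => //; rewrite ?lee_fin.
Qed.

Lemma L2on_le (c : R) E f g : cmeas f -> L2on mu E g -> 0 <= c ->
  (forall x, csq (f x) <= c * csq (g x)) -> L2on mu E f.
Proof.
move=> mf [g2 gE] c0 fg; split; first exact: L2_le g2 c0 fg.
apply: filterS gE => x gx Ex; apply/eqP; rewrite -csq_eq0 eq_le csq_ge0 andbT.
by rewrite (le_trans (fg x))// gx// csq0 mulr0.
Qed.

Lemma L2onD E f g : L2on mu E f -> L2on mu E g -> L2on mu E (fun x => f x + g x).
Proof.
move=> [f2 fE] [g2 gE]; split; first exact: L2D.
by apply: filterS2 fE gE => x fx gx Ex; rewrite fx// gx// addr0.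
Qed.

Lemma L2onN E f : L2on mu E f -> L2on mu E (fun x => - f x).
Proof.
move=> fE; apply: (L2on_le _ fE ler01) => [|x].
  by apply: cmeasN; case: fE => -[].
by rewrite csqN mul1r.
Qed.

End SquareIntegrable.

(** * The operators of a projective system and their adjoints *)

Section ProjectiveSystem.
Variables (k : nat) (L : kgraph k) (x0 : ipath L) (R : realType).
Local Notation X := (IPS x0).
Local Notation C := (complex R).
Variable mu : {measure set X -> \bar R}.
Variable f : kmor L -> X -> C.
Hypothesis pf : projective_system mu f.
Implicit Types (l : kmor L) (g h : X -> C) (A B E : set X).

Local Notation dom l := (Z (kid (ks l)) : set X).

(** * Prefixing maps and the zero sets of the densities *)

Lemma prefixP l (y : X) : dom l y ->
  Z l (prefix l y : X) /\ sig (kdeg l) (prefix l y) = y.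
Proof.
move=> /cyl_prefix[x xP].
have := @xgetPex X x0 [set x : X | Z l x /\ sig (kdeg l) x = y].
by apply; exists x.
Qed.

(** Both paths lie in Z(l) and have the same shift, and the shift is injective on a cylinder. *)
Lemma prefixK l (x : X) : Z l x -> prefix l (sig (kdeg l) x) = x.
Proof.
move=> lx; have [lp e] := prefixP (cyl_id_shift lx).
exact: cyl_shift_inj e.
Qed.

(** Images under [prefix] become measurable once they are written through a preimage of the
    shift. *)
Lemma image_prefix l A : A `<=` dom l ->
  prefix l @` A = (Z l : set X) `&` sig (kdeg l) @^-1` A.
Proof.
move=> Al; apply/seteqP; split => [_ [y Ay <-]|x [lx Ax]] /=.
  by have [? ->] := prefixP (Al _ Ay).
by exists (sig (kdeg l) x) => //; exact: prefixK.
Qed.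

Lemma measurable_sig n : measurable_fun setT (sig n : X -> X).
Proof. by case: pf => /(_ n)[]. Qed.

Lemma measurable_prefix l : measurable_fun (dom l) (prefix l : X -> X).
Proof. by case: pf => /(_ (kdeg l))[_ /(_ l erefl)[]]. Qed.

Lemma cmeas_density l : cmeas (f l).
Proof. by case: pf => _ /(_ l)[]. Qed.

Lemma measure_preimage_prefix l A : measurable A ->
  mu (dom l `&` prefix l @^-1` A) = (\int[mu]_(x in A) (csq (f l x))%:E)%E.
Proof. by move=> mA; case: pf => _ _ _ /(_ l)[_ _ ->]. Qed.

Lemma ge0_integral_prefix l (r : X -> R) :
  measurable_fun setT r -> (forall x, 0 <= r x) ->
  (\int[mu]_x (r x * csq (f l x))%:E = \int[mu]_(y in dom l) (r (prefix l y))%:E)%E.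
Proof.
apply: ge0_integral_image.
- exact: measurable_cyl.
- exact: measurable_prefix.
- exact: (measurable_csq (cmeas_density l)).
- by move=> x; exact: csq_ge0.
- exact: measure_preimage_prefix.
Qed.

Lemma Rintegral_prefix l (r : X -> R) : measurable_fun setT r ->
  Rintegral mu setT (fun x => r x * csq (f l x)) =
  Rintegral mu (dom l) (fun y => r (prefix l y)).
Proof.
apply: Rintegral_image.
- exact: measurable_cyl.
- exact: measurable_prefix.
- exact: (measurable_csq (cmeas_density l)).
- by move=> x; exact: csq_ge0.
- exact: measure_preimage_prefix.
Qed.

Lemma integral_csq_eq0 A g : measurable A -> cmeas g ->
  (\int[mu]_(x in A) (csq (g x))%:E = 0)%E ->
  {ae mu, forall x, A x -> g x = 0}.
Proof.
move=> mA mg g0.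
have mEg : measurable_fun A (fun x => (csq (g x))%:E).
  exact: (measurable_funTS (measurable_csqE mg)).
have /(ae_eq_integral_abs mu mA mEg) : (\int[mu]_(x in A) `|(csq (g x))%:E| = 0)%E.
  by under eq_integral do rewrite gee0_abs ?lee_fin ?csq_ge0//.
by apply: filterS => x h Ax; have [/eqP] := h Ax; rewrite csq_eq0 => /eqP.
Qed.

(** For a null set [N], the integral of |f_l|^2 over its preimage by the shift is the measure of the
    part of [N] in Z(s(l)), because the shift undoes [prefix]. Hence f_l vanishes a.e. on that
    preimage. *)
Lemma ae_density_sig l (P : X -> Prop) : {ae mu, forall y, P y} ->
  {ae mu, forall x, f l x <> 0 -> P (sig (kdeg l) x)}.
Proof.
move=> [N [mN N0 PN]].
have mS : measurable (sig (kdeg l) @^-1` N : set X).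
  by rewrite -[_ @^-1` _]setTI; exact: measurable_sig.
have /(integral_csq_eq0 mS (cmeas_density l)) :
    (\int[mu]_(x in sig (kdeg l) @^-1` N) (csq (f l x))%:E = 0)%E.
  rewrite -measure_preimage_prefix//; apply: (subset_measure0 _ mN _ N0).
    by apply: measurable_prefix => //; exact: measurable_cyl.
  by move=> y [ly] /=; rewrite (prefixP ly).2.
apply: filterS => x h fx; apply: contrapT => Px.
by apply/fx/h/PN.
Qed.

(** The push-forward of [mu] under [prefix] has a density, so preimages of null sets are null. *)
Lemma ae_prefix l (P : X -> Prop) : {ae mu, forall x, P x} ->
  {ae mu, forall y, dom l y -> P (prefix l y)}.
Proof.
move=> [N [mN N0 PN]]; exists (dom l `&` prefix l @^-1` N); split.
- by apply: measurable_prefix => //; exact: measurable_cyl.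
- rewrite measure_preimage_prefix//.
  under eq_integral do rewrite -[_%:E]gee0_abs ?lee_fin ?csq_ge0//.
  apply: integral_abs_eq0 => //.
  exact: (measurable_funTS (measurable_csqE (cmeas_density l))).
- by move=> y /= /not_implyP[ly Py]; split=> //; exact: PN.
Qed.

(** [prefix] takes no value outside Z(l), so |f_l|^2 has integral 0 there. *)
Lemma ae_density_out l : {ae mu, forall x, ~ Z l x -> f l x = 0}.
Proof.
apply: (@integral_csq_eq0 (~` Z l)); [|exact: cmeas_density|].
  by apply: measurableC; exact: measurable_cyl.
rewrite -measure_preimage_prefix; last first.
  by apply: measurableC; exact: measurable_cyl.
rewrite [X in mu X](_ : _ = set0) ?measure0// -subset0 => y [ly].
by apply; have [] := prefixP ly.
Qed.

Lemma ae_density_prefix l : {ae mu, forall y, dom l y -> f l (prefix l y) <> 0}.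
Proof.
have m0 := measurable_eq0 (cmeas_density l).
exists (dom l `&` prefix l @^-1` [set x | f l x = 0]); split.
- by apply: measurable_prefix => //; exact: measurable_cyl.
- rewrite measure_preimage_prefix//; apply: integral0_eq => x /= ->.
  by rewrite csq0.
- by move=> y /= /not_implyP[ly /contrapT].
Qed.

(** The zeros of f_l in Z(l) are the [prefix] image of the null set of [ae_density_prefix]. That
    image is null by the other derivative, that of A |-> mu(sigma_l(A)) in the semibranching
    axioms. *)
Lemma ae_density_cyl l : {ae mu, forall x, Z l x -> f l x <> 0}.
Proof.
have [N [mN N0 fN]] := ae_density_prefix l.
have mDN : measurable (dom l `&` N) by apply: measurableI => //; exact: measurable_cyl.
exists (prefix l @` (dom l `&` N)); split.
- rewrite image_prefix; last exact: subIsetl.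
  apply: measurableI; first exact: measurable_cyl.
  by rewrite -[_ @^-1` _]setTI; exact: measurable_sig.
- case: pf => /(_ (kdeg l))[_ _ _ _ /(_ l erefl)[Phi [[mPhi Phi0 PhiE] _]]] _ _ _ _.
  rewrite PhiE//.
  rewrite (eq_integral (abse \o Phi)) => [|x /set_mem[lx _]]; last first.
    by rewrite /= gee0_abs// Phi0.
  rewrite integral_abs_eq0//.
    by apply: measurable_funS mPhi => //; exact: measurable_cyl.
  by apply: (subset_measure0 _ mN _ N0) => //; exact: subIsetr.
- move=> x /= /not_implyP[lx /contrapT fx]; exists (sig (kdeg l) x); last exact: prefixK.
  split; first exact: cyl_id_shift.
  by apply: fN => /=; rewrite prefixK//; apply/not_implyP; split; [exact: cyl_id_shift|apply].
Qed.

(** Pairing T_l g with h produces the conjugate of f_l, which is |f_l|^2 / f_l; the change of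
    variables absorbs |f_l|^2 and leaves the division. *)
Definition Tadj l g : X -> C :=
  fun y => if y \in dom l then g (prefix l y) / f l (prefix l y) else 0.

Lemma cmeas_Top l g : cmeas g -> cmeas (Top f l g).
Proof.
move=> mg; apply: cmeasM; first exact: cmeas_density.
exact: (cmeas_comp (measurable_sig _)).
Qed.

Lemma cmeas_Tadj l g : cmeas g -> cmeas (Tadj l g).
Proof.
move=> mg; have [mr mi] := cmeasM mg (cmeasV (cmeas_density l)).
have mD : measurable (dom l) by exact: measurable_cyl.
have sub : [set: X] `&` (fun y => y \in dom l) @^-1` [set true] = dom l.
  by rewrite setTI; apply/seteqP; split => y /=; [move=> /set_mem|move=> /mem_set].
have md : measurable_fun setT (fun y : X => y \in dom l).
  by apply: (measurable_fun_bool true) => //; rewrite sub.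
split.
- rewrite (_ : (fun x => _) = fun y => if y \in dom l then
      ((fun x => complex.Re (g x * (f l x)^-1)) \o prefix l) y else 0).
    apply: measurable_fun_if => //; rewrite sub.
    by apply: measurable_comp mr _ => //; exact: measurable_prefix.
  by apply/funext => y; rewrite /Tadj; case: ifP.
- rewrite (_ : (fun x => _) = fun y => if y \in dom l then
      ((fun x => complex.Im (g x * (f l x)^-1)) \o prefix l) y else 0).
    apply: measurable_fun_if => //; rewrite sub.
    by apply: measurable_comp mi _ => //; exact: measurable_prefix.
  by apply/funext => y; rewrite /Tadj; case: ifP.
Qed.

(** The change of variables turns the squared norm of T_l g into the integral of |g|^2 over
    Z(s(l)). *)
Lemma L2_Top l g : L2 mu g -> L2 mu (Top f l g).
Proof.
move=> [mg g2]; split; first exact: cmeas_Top.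
have mD : measurable (dom l) by exact: measurable_cyl.
under eq_integral do rewrite csqM mulrC.
rewrite (@ge0_integral_prefix l (fun x => csq (g (sig (kdeg l) x)))); last 2 first.
- exact: (measurable_csq (cmeas_comp (measurable_sig (kdeg l)) mg)).
- by move=> x; exact: csq_ge0.
under eq_integral => y /set_mem ly do rewrite (prefixP ly).2.
apply: le_lt_trans g2; apply: ge0_subset_integral => //.
- exact: measurable_csqE.
- by move=> x _; rewrite lee_fin csq_ge0.
Qed.

(** The change of variables, read backwards, gives the integrand |g / f_l|^2 |f_l|^2, which is at
    most |g|^2 and is 0 where f_l vanishes. *)
Lemma L2_Tadj l g : L2 mu g -> L2 mu (Tadj l g).
Proof.
move=> [mg g2]; split; first exact: cmeas_Tadj.
have mD : measurable (dom l) by exact: measurable_cyl.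
have mgf := cmeasM mg (cmeasV (cmeas_density l)).
rewrite (_ : (\int[mu]_x _ = \int[mu]_(y in dom l)
    (csq (g (prefix l y) * (f l (prefix l y))^-1))%:E)%E); last first.
  rewrite [RHS]integral_mkcond; apply: eq_integral => y _.
  by rewrite patchE /Tadj; case: ifP => // _; rewrite csq0.
rewrite -(@ge0_integral_prefix l (fun x => csq (g x * (f l x)^-1))); last 2 first.
- exact: measurable_csq.
- by move=> x; exact: csq_ge0.
apply: le_lt_trans g2; apply: ge0_le_integral => //.
- by move=> x _; rewrite lee_fin mulr_ge0 ?csq_ge0.
- apply/measurable_EFinP/measurable_funM; first exact: measurable_csq.
  exact: (measurable_csq (cmeas_density l)).
- exact: measurable_csqE.
- move=> x _; rewrite lee_fin csqM csqV -mulrA.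
  have [->|c0] := eqVneq (csq (f l x)) 0; first by rewrite !mulr0 csq_ge0.
  by rewrite mulVf// mulr1.
Qed.

(** The weight extracted by [mul_conj_div] is exactly the density in [Rintegral_prefix], applied to
    the real and imaginary parts in turn. *)
Lemma cinner_Top l g h : cmeas g -> cmeas h ->
  cinner mu (Top f l g) h = cinner mu g (Tadj l h).
Proof.
move=> mg mh; have mhf := cmeasM mh (cmeasV (cmeas_density l)).
have [mr mi] := cmeasM (cmeas_comp (measurable_sig (kdeg l)) mg) (cmeas_conj mhf).
rewrite /cinner /Top; congr Complex.
- transitivity (Rintegral mu setT (fun x =>
      complex.Re (g (sig (kdeg l) x) * conjc (h x * (f l x)^-1)) * csq (f l x))).
    by apply: eq_Rintegral => x _; rewrite mul_conj_div Re_realM mulrC.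
  rewrite (Rintegral_prefix _ mr) Rintegral_mkcond; apply: eq_Rintegral => y _.
  rewrite patchE /Tadj; case: ifP => [/set_mem ly|_].
    by rewrite (prefixP ly).2.
  by rewrite conjc0 mulr0.
- transitivity (Rintegral mu setT (fun x =>
      complex.Im (g (sig (kdeg l) x) * conjc (h x * (f l x)^-1)) * csq (f l x))).
    by apply: eq_Rintegral => x _; rewrite mul_conj_div Im_realM mulrC.
  rewrite (Rintegral_prefix _ mi) Rintegral_mkcond; apply: eq_Rintegral => y _.
  rewrite patchE /Tadj; case: ifP => [/set_mem ly|_].
    by rewrite (prefixP ly).2.
  by rewrite conjc0 mulr0.
Qed.

(** Off Z(l) the factor f_l is a.e. 0; on Z(l) it is a.e. nonzero and cancels. *)
Lemma Top_Tadj l g : {ae mu, forall x, Top f l (Tadj l g) x = (\1_(Z l) x)%:C * g x}.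
Proof.
apply: filterS2 (ae_density_out l) (ae_density_cyl l) => x out inn.
rewrite /Top indicE; have [lx|lx] := pselect (Z l x).
  rewrite (mem_set lx) mul1r /Tadj (mem_set (cyl_id_shift lx)) prefixK//.
  by rewrite mulrC divfK//; apply/eqP/inn.
by rewrite (memNset lx) mul0r out// mul0r.
Qed.

Lemma Tadj_Top l g : {ae mu, forall y, Tadj l (Top f l g) y = (\1_(dom l) y)%:C * g y}.
Proof.
apply: filterS (ae_density_prefix l) => y ly.
rewrite /Tadj /Top indicE; case: ifPn => [/set_mem yl|]; last by rewrite mul0r.
rewrite (prefixP yl).2 mul1r mulrC mulKf//; exact/eqP/ly.
Qed.

(** * Stability of L^2(E) under the operators and their adjoints *)

Section Invariant.
Variable E : set X.
Hypothesis invE : mu_invariant mu E.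

Lemma ae_invariant n : {ae mu, forall x, E x <-> E (sig n x)}.
Proof.
case: invE => mE _ /(_ n) E0.
have mS : measurable (sig n @^-1` E : set X).
  by rewrite -[_ @^-1` _]setTI; exact: measurable_sig.
exists (symdiff E (sig n @^-1` E)); split=> //.
  by apply: measurableU; exact: measurableD.
move=> x /=; apply: contra_notP => /not_orP[h1 h2]; split => Ex.
  by apply: contrapT => ?; apply: h1.
by apply: contrapT => ?; apply: h2.
Qed.

(** For almost every point outside [E] the shifted point is outside [E] too. The exceptional null
    set of [g] is pulled back by [ae_density_sig], and where f_l vanishes so does the product. *)
Lemma L2on_Top l g : L2on mu E g -> L2on mu E (Top f l g).
Proof.
move=> [g2 gE]; split; first exact: L2_Top.
apply: filterS2 (ae_density_sig l gE) (ae_invariant (kdeg l)) => x gx Ex nEx.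
rewrite /Top; have [->|/eqP fx] := eqVneq (f l x) 0; first exact: mul0r.
by rewrite gx ?mulr0// => /Ex.
Qed.

Lemma L2on_Tadj l g : L2on mu E g -> L2on mu E (Tadj l g).
Proof.
move=> [g2 gE]; split; first exact: L2_Tadj.
apply: filterS2 (ae_prefix l gE) (ae_prefix l (ae_invariant (kdeg l))) => y gy Ey nEy.
rewrite /Tadj; case: ifP => // /set_mem ly; rewrite gy ?mul0r//.
by move=> /(Ey ly); rewrite (prefixP ly).2.
Qed.

End Invariant.
End ProjectiveSystem.

(** * Nondegeneracy of the inner product on L^2(E) *)

Section Separation.
Variables (k : nat) (L : kgraph k) (x0 : ipath L) (R : realType).
Local Notation X := (IPS x0).
Local Notation C := (complex R).
Variable mu : {measure set X -> \bar R}.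
Implicit Types (g h : X -> C) (E : set X).

Lemma integrable_csq g : L2 mu g -> mu.-integrable setT (EFin \o (fun x => csq (g x))).
Proof.
move=> [mg g2]; apply/integrableP; split; first exact: measurable_csqE.
by under eq_integral do rewrite /= ger0_norm ?csq_ge0//.
Qed.

Lemma integrable_Re_inner g h : L2 mu g -> L2 mu h ->
  mu.-integrable setT (EFin \o (fun x => complex.Re (g x * conjc (h x)))).
Proof.
move=> g2 h2.
have := integrableD measurableT (integrable_csq g2) (integrable_csq h2).
apply: le_integrable => //.
  apply/measurable_EFinP.
  by have [] := cmeasM g2.1 (cmeas_conj h2.1).
move=> x _ /=; rewrite lee_fin [leRHS]ger0_norm; last by rewrite addr_ge0 ?csq_ge0.
case: (g x) (h x) => [a b] [c d]; rewrite /csq /= ler_norml.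
(* The four squares bound 2|ac| by a^2 + c^2 and 2|bd| by b^2 + d^2. *)
have := sqr_ge0 (a + c); have := sqr_ge0 (a - c).
have := sqr_ge0 (b + d); have := sqr_ge0 (b - d).
by rewrite !sqrrD !sqrrN => *; apply/andP; split; nra.
Qed.

(** Test with u = g - h: the real parts of the two inner products differ by the integral of
    |u|^2. *)
Lemma cinner_separates E g h : L2on mu E g -> L2on mu E h ->
  (forall u, L2on mu E u -> cinner mu u g = cinner mu u h) ->
  {ae mu, forall x, g x = h x}.
Proof.
move=> gE hE gh; pose u x := g x + - h x.
have uE : L2on mu E u by apply: L2onD => //; exact: L2onN.
have := congr1 (@complex.Re _) (gh _ uE) => /= /eqP.
rewrite -subr_eq0 -RintegralB//; last 2 first.
- exact: integrable_Re_inner uE.1 gE.1.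
- exact: integrable_Re_inner uE.1 hE.1.
rewrite (_ : Rintegral _ _ _ = Rintegral mu setT (fun x => csq (u x))); last first.
  apply: eq_Rintegral => x _; rewrite /u.
  by case: (g x) (h x) => [a b] [c d]; rewrite /csq /=; ring.
have u0 : (0 <= \int[mu]_x (csq (u x))%:E)%E.
  by apply: integral_ge0 => x _; rewrite lee_fin csq_ge0.
rewrite /Rintegral fine_eq0; last by rewrite ge0_fin_numE//; case: uE => -[].
move=> /eqP /(integral_csq_eq0 measurableT uE.1.1).
by apply: filterS => x /(_ I)/eqP; rewrite subr_eq0 => /eqP.
Qed.

End Separation.

(** * Reducing subspaces *)

Section Reducing.
Variables (k : nat) (L : kgraph k) (x0 : ipath L) (R : realType).
Local Notation X := (IPS x0).
Local Notation C := (complex R).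
Variable mu : {measure set X -> \bar R}.
Variable f : kmor L -> X -> C.
Hypothesis pf : projective_system mu f.
Variable E : set X.
Hypothesis invE : mu_invariant mu E.
Variable M : set (X -> C).
Hypotheses (hM : closed_subspace mu E M) (rM : reducing mu f E M).
Implicit Types (l : kmor L) (g h : X -> C) (A B : set X).

Local Notation dom l := (Z (kid (ks l)) : set X).
Local Notation restr A g := (fun x => (\1_A x)%:C * g x).

Lemma reducing_L2on g : M g -> L2on mu E g.
Proof. by case: hM => + _ _ _ _; apply. Qed.

Lemma reducing0 : M (fun _ => 0). Proof. by case: hM. Qed.

Lemma reducingD g h : M g -> M h -> M (fun x => g x + h x).
Proof. by case: hM => _ _ [+ _] _ _; apply. Qed.

Lemma reducingZ c g : M g -> M (fun x => c * g x).
Proof. by case: hM => _ _ [_ +] _ _; apply. Qed.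

Lemma reducingB g h : M g -> M h -> M (fun x => g x - h x).
Proof.
move=> Mg Mh; have := reducingD Mg (reducingZ (- 1) Mh).
by congr M; apply/funext => x; rewrite mulN1r.
Qed.

Lemma reducing_ae g h : M g -> L2on mu E h -> {ae mu, forall x, g x = h x} -> M h.
Proof. by case: hM => _ _ _ + _; apply. Qed.

(** Dominated convergence, with integrable bound |h|^2, turns pointwise convergence into convergence
    in norm, under which [M] is closed. *)
Lemma reducing_dominated (u : nat -> X -> C) g h : (forall m, M (u m)) ->
  L2on mu E g -> L2 mu h -> (forall m x, csq (u m x - g x) <= csq (h x)) ->
  (forall x, csq (u m x - g x) @[m --> \oo] --> 0) -> M g.
Proof.
move=> Mu gE h2 ugh ug; case: hM => _ _ _ _ /(_ u g Mu gE); apply.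
have mug m : measurable_fun setT (fun x => (csq (u m x - g x))%:E).
  apply: measurable_csqE; apply: cmeasD; first exact: (reducing_L2on (Mu m)).1.1.
  exact/cmeasN/gE.1.1.
have := @dominated_convergence _ X R mu setT measurableT
  (fun m x => (csq (u m x - g x))%:E) (cst 0%E) (fun x => (csq (h x))%:E) mug.
case=> //.
- by apply: aeW => x _; apply: cvg_EFin; [exact: nearW|exact: ug].
- exact: integrable_csq.
- by apply: aeW => x m _; rewrite gee0_abs ?lee_fin ?csq_ge0.
- by move=> _ _; rewrite integral0.
Qed.

(** [reducing] only provides some [h] in [M] that represents the adjoint on L^2(E); it agrees a.e.
    with [Tadj], as both have the same inner products. *)
Lemma reducing_Tadj l g : M g -> M (Tadj f l g).
Proof.
move=> Mg; have [_ /(_ g Mg)[h [Mh hP]]] := rM l.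
have gE := reducing_L2on Mg.
apply: (reducing_ae Mh); first exact: L2on_Tadj.
apply: (@cinner_separates _ _ _ _ _ E) => [||u uE].
- exact: reducing_L2on.
- exact: L2on_Tadj.
- by rewrite -hP// cinner_Top//; [exact: uE.1.1|exact: gE.1.1].
Qed.

(** * Multiplication by Borel indicators and by nonnegative functions *)

Lemma L2on_restr A g : measurable A -> L2on mu E g -> L2on mu E (restr A g).
Proof.
move=> mA gE; apply: (L2on_le _ gE ler01) => [|x].
  apply: cmeasM; last exact: gE.1.1.
  exact/cmeas_real/measurable_indic.
by rewrite csqM csq_real ler_wpM2r ?csq_ge0.
Qed.

Lemma reducing_cyl l g : M g -> M (restr (Z l) g).
Proof.
move=> Mg; have [/(_ _ (reducing_Tadj l Mg)) MT _] := rM l.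
apply: (reducing_ae MT); last exact: Top_Tadj.
by apply: L2on_restr; [exact: measurable_cyl|exact: reducing_L2on].
Qed.

(** At each point the restrictions to the partial unions are eventually constant, and their errors
    are dominated by |g|. This serves both the sigma-algebra argument and [fills_bigcup]. *)
Lemma reducing_bigcup (F : nat -> set X) g : (forall n, measurable (F n)) ->
  L2on mu E g -> (forall m, M (restr (\big[setU/set0]_(i < m) F i) g)) ->
  M (restr (\bigcup_n F n) g).
Proof.
move=> mF gE MF.
have sub m : \big[setU/set0]_(i < m) F i `<=` \bigcup_n F n.
  by rewrite -bigcup_mkord => x [n _ Fx]; exists n.
apply: (reducing_dominated MF _ gE.1).
- by apply: L2on_restr => //; exact: bigcupT_measurable.
- move=> m x; rewrite -mulrBl csqM ler_piMl ?csq_ge0// !indicE.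
  case: (boolP (x \in \big[setU/set0]_(i < m) F i)) => [/set_mem/sub/mem_set ->|_].
    by rewrite subrr csq0.
  by case: (x \in _); rewrite ?sub0r ?csqN csq_real ?expr1n ?expr0n.
- move=> x; apply: cvg_near_cst.
  have [[n _ Fx]|nF] := pselect ((\bigcup_n F n) x).
    near=> m; rewrite !indicE mem_set; last first.
      rewrite -bigcup_mkord; exists n => //=; near: m.
      exact: nbhs_infty_gt.
    by rewrite mem_set ?subrr ?csq0//; exists n.
  near=> m; rewrite !indicE !memNset// ?subrr ?csq0//.
  by move/sub.
Unshelve. all: by end_near. Qed.

Lemma reducing_restr A g : measurable A -> M g -> M (restr A g).
Proof.
move=> mA; move: A mA g.
pose G := [set A : set X | measurable A /\ forall g, M g -> M (restr A g)].
suff GA : (@measurable _ X) `<=` G by move=> A /GA[].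
apply: smallest_sub => [|_ [l _ <-]]; last first.
  by split; [exact: measurable_cyl|exact: reducing_cyl].
have GU A B : G A -> G B -> G (A `|` B).
  move=> [mA GA] [mB GB]; split; first exact: measurableU.
  (* Inclusion-exclusion. The indicator of the intersection comes from restricting twice, which is
     why [G] quantifies over all members of [M]. *)
  move=> g Mg; have := reducingB (reducingD (GA _ Mg) (GB _ Mg)) (GA _ (GB _ Mg)).
  congr M; apply/funext => x; rewrite !indicE in_setU.
  by case: (x \in A); case: (x \in B) => /=; ring.
have G0 : G set0.
  split=> // g Mg; have := reducing0; congr M; apply/funext => x.
  by rewrite indic0 mul0r.
split=> //.
- move=> A [mA GA]; split; first by rewrite setTD; exact: measurableC.
  move=> g Mg; have := reducingB Mg (GA _ Mg).
  congr M; apply/funext => x; rewrite !indicE in_setD in_setT /=.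
  by case: (x \in A) => /=; ring.
- move=> F GF; have mF n : (@measurable _ X) (F n) by case: (GF n).
  split=> [|g Mg]; first exact: (@bigcupT_measurable _ X).
  apply: (@reducing_bigcup F) => //; first exact: reducing_L2on.
  move=> m; suff : G (\big[setU/set0]_(i < m) F i) by case=> _; apply.
  by elim/big_ind: _ => // i _.
Qed.

Import HBNNSimple.

Lemma reducing_nnsfun (r : {nnsfun X >-> R}) g : M g -> M (fun x => (r x)%:C * g x).
Proof.
move=> Mg; rewrite (_ : (fun x => _) = fun x =>
    (\sum_(y <- finmap.enum_fset (fset_set (range r)))
      y * \1_(r @^-1` [set y]) x)%:C * g x); last first.
  by apply/funext => x; rewrite fimfunE fsbig_finite.
elim: (finmap.enum_fset _) => [|y s IH].
  have := reducing0; congr M; apply/funext => x.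
  by rewrite big_nil mul0r.
have my : measurable (r @^-1` [set y]) by exact: measurable_funPTI.
have := reducingD (reducingZ y%:C (reducing_restr my Mg)) IH.
congr M; apply/funext => x.
by rewrite big_cons rmorphD rmorphM /= mulrDl mulrA.
Qed.

(** The simple functions [s n] stay between 0 and [r], so the errors are dominated by |r g|^2,
    integrable by assumption even for unbounded [r]. *)
Lemma reducing_nonneg (r : X -> R) g : measurable_fun setT r ->
  (forall x, 0 <= r x) -> M g -> L2on mu E (fun x => (r x)%:C * g x) ->
  M (fun x => (r x)%:C * g x).
Proof.
move=> mr r0 Mg rgE.
have mEr : measurable_fun setT (EFin \o r) by exact/measurable_EFinP.
pose s := nnsfun_approx measurableT mEr.
have scvg x : s n x @[n --> \oo] --> r x.
  suff /fine_cvgP[] : EFin \o s ^~ x @ \oo --> (r x)%:E by [].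
  by apply: (cvg_nnsfun_approx measurableT mEr) => // y _; rewrite lee_fin.
have sr n x : s n x <= r x.
  rewrite -(cvg_lim _ (scvg x))//.
  apply: nondecreasing_cvgn_le; last by apply/cvg_ex; exists (r x).
  by move=> i j ij; exact/lefP/nd_nnsfun_approx.
have csqE n x : csq ((s n x)%:C * g x - (r x)%:C * g x) =
    (s n x - r x) ^+ 2 * csq (g x).
  by rewrite -mulrBl csqM -rmorphB csq_real.
apply: (reducing_dominated (fun n => reducing_nnsfun (s n) Mg) rgE rgE.1).
- move=> n x; rewrite csqE csqM csq_real ler_wpM2r ?csq_ge0//.
  by have := sr n x; have : 0 <= s n x by []; have := r0 x; nra.
- move=> x; under eq_fun do rewrite csqE.
  suff : (s n x - r x) ^+ 2 * csq (g x) @[n --> \oo] -->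
      (r x - r x) ^+ 2 * csq (g x) by rewrite subrr expr0n mul0r.
  apply: cvgM; last exact: cvg_cst.
  by apply: cvgM; apply: cvgB => //; exact: cvg_cst.
Qed.

(** [A] ranges over the Borel sets of the whole path space, so that exact preimages and saturations
    can be formed; the cut down to [E] is carried by [h]. *)
Definition fills A := measurable A /\
  forall h, L2on mu E h -> {ae mu, forall x, ~ A x -> h x = 0} -> M h.

(** Write h = q g with q = h / g, and split [q] into the positive and negative parts of its real and
    imaginary parts; each is at most |q|, so its product with [g] stays in L^2(E). *)
Lemma fills_support g : M g -> fills [set x | g x <> 0].
Proof.
move=> Mg; have gE := reducing_L2on Mg; have mg := gE.1.1.
split; first exact: measurableC (measurable_eq0 mg).
move=> h hE h0; have mh := hE.1.1.
pose q x := h x * (g x)^-1; have mq : cmeas q by apply: cmeasM => //; exact: cmeasV.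
have qg x : csq (q x) * csq (g x) <= csq (h x).
  rewrite -csqM /q; have [->|g0] := eqVneq (g x) 0; first by rewrite mulr0 csq0 csq_ge0.
  by rewrite divfK.
have part (r : X -> R) : measurable_fun setT r -> (forall x, 0 <= r x) ->
    (forall x, r x ^+ 2 <= csq (q x)) -> M (fun x => (r x)%:C * g x).
  move=> mr r0 rq; apply: reducing_nonneg => //.
  apply: (L2on_le _ hE ler01) => [|x]; first exact/cmeasM/mg/cmeas_real.
  by rewrite mul1r csqM csq_real (le_trans _ (qg x))// ler_wpM2r ?csq_ge0.
have sqmax (a b : R) : Num.max a 0 ^+ 2 <= a ^+ 2 + b ^+ 2.
  by have := sqr_ge0 b; have := sqr_ge0 a; case: (ltP a 0) => _; nra.
have max_ge0 (a : R) : 0 <= Num.max a 0 by rewrite le_max lexx orbT.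
have subr_max (a : R) : Num.max a 0 - Num.max (- a) 0 = a.
  have [a0|a0] := leP 0 a.
    by rewrite max_r ?subr0// oppr_le0.
  by rewrite max_l ?oppr_ge0 1?ltW// sub0r opprK.
have Mre : M (fun x => (complex.Re (q x))%:C * g x).
  have := @reducingB (fun x => (Num.max (complex.Re (q x)) 0)%:C * g x)
    (fun x => (Num.max (- complex.Re (q x)) 0)%:C * g x).
  have -> : (fun x => (Num.max (complex.Re (q x)) 0)%:C * g x -
      (Num.max (- complex.Re (q x)) 0)%:C * g x) = fun x => (complex.Re (q x))%:C * g x.
    apply/funext => x; rewrite -mulrBl -rmorphB /=; congr (_%:C * _).
    exact: subr_max.
  apply; apply: part => // [|x].
  - exact: measurable_funrpos mq.1.
  - exact: sqmax.
  - exact: measurable_funrneg mq.1.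
  - by rewrite /csq -[complex.Re _ ^+ 2]sqrrN; exact: sqmax.
have Mim : M (fun x => (complex.Im (q x))%:C * g x).
  have := @reducingB (fun x => (Num.max (complex.Im (q x)) 0)%:C * g x)
    (fun x => (Num.max (- complex.Im (q x)) 0)%:C * g x).
  have -> : (fun x => (Num.max (complex.Im (q x)) 0)%:C * g x -
      (Num.max (- complex.Im (q x)) 0)%:C * g x) = fun x => (complex.Im (q x))%:C * g x.
    apply/funext => x; rewrite -mulrBl -rmorphB /=; congr (_%:C * _).
    exact: subr_max.
  apply; apply: part => // [|x].
  - exact: measurable_funrpos mq.2.
  - by rewrite /csq addrC; exact: sqmax.
  - exact: measurable_funrneg mq.2.
  - by rewrite /csq addrC -[complex.Im _ ^+ 2]sqrrN; exact: sqmax.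
apply: (reducing_ae (reducingD Mre (reducingZ 'i%C Mim)) hE).
(* Where [g] vanishes the quotient is 0 by convention, and [h] is a.e. 0 there by assumption. *)
apply: filterS h0 => x h0.
rewrite mulrA -mulrDl -complexE /q.
by have [g0|g0] := eqVneq (g x) 0; [rewrite g0 mulr0 h0|rewrite divfK].
Qed.


(** * Stability of filled sets under countable unions, shifts and prefixing *)

Lemma fillsS A B : measurable B -> B `<=` A -> fills A -> fills B.
Proof.
move=> mB BA [_ fA]; split=> // h hE h0; apply: fA => //.
by apply: filterS h0 => x hx Ax; apply: hx => /BA.
Qed.

Lemma fills0 : fills set0.
Proof.
split=> // h hE h0; apply: (reducing_ae reducing0 hE).
by apply: filterS h0 => x ->.
Qed.

Lemma fills_bigcup (F : nat -> set X) : (forall n, fills (F n)) ->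
  fills (\bigcup_n F n).
Proof.
move=> FF; have mF n : measurable (F n) by case: (FF n).
split=> [|h hE h0]; first exact: bigcupT_measurable.
suff : M (restr (\bigcup_n F n) h).
  move/reducing_ae; apply=> //; apply: filterS h0 => x hx; rewrite indicE.
  have [Fx|Fx] := pselect ((\bigcup_n F n) x); first by rewrite mem_set ?mul1r.
  by rewrite hx ?mulr0.
apply: reducing_bigcup => // m; elim: m => [|m IH].
  have := reducing0; congr M; apply/funext => x.
  by rewrite big_ord0 indic0 mul0r.
set B := \big[setU/set0]_(i < m) F i in IH.
have mB : measurable B by apply: bigsetU_measurable.
(* The sets are made disjoint: the new piece of [h] is carried by [F m] alone. *)
have : M (restr (F m `\` B) h).
  apply: (FF m).2; first by apply: L2on_restr => //; exact: measurableD.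
  by apply: aeW => x Fx; rewrite indicE memNset ?mul0r// => -[].
move/(reducingD IH); congr M; apply/funext => x.
rewrite big_ord_recr /= -/B !indicE in_setU in_setD.
by case: (x \in B); case: (x \in F m) => /=; ring.
Qed.

Lemma fills_bigcup_countable (I : countType) (F : I -> set X) :
  (forall i, fills (F i)) -> fills (\bigcup_i F i).
Proof.
move=> FF; pose G n := if unpickle n is Some i then F i else set0.
rewrite (_ : \bigcup_i F i = \bigcup_n G n).
  by apply: fills_bigcup => n; rewrite /G; case: unpickle => [i|]; [exact: FF|exact: fills0].
apply/seteqP; split => x [].
  by move=> i _ Fx; exists (pickle i) => //; rewrite /G pickleK.
by move=> n _; rewrite /G; case: unpickle => // i Fx; exists i.
Qed.

Lemma measurable_preimage_sig n A : measurable A -> measurable (sig n @^-1` A : set X).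
Proof. by move=> mA; rewrite -[_ @^-1` _]setTI; exact: (measurable_sig pf). Qed.

(** If [h] is carried by this set, then T_l^* h is carried by [A], hence lies in [M], and T_l brings
    it back to [h]. *)
Lemma fills_preimage_sig_cyl l A : fills A ->
  fills (sig (kdeg l) @^-1` A `&` (Z l : set X)).
Proof.
move=> [mA fA]; split.
  by apply: measurableI; [exact: measurable_preimage_sig|exact: measurable_cyl].
move=> h hE h0; have : M (Tadj f l h).
  apply: fA; first exact: L2on_Tadj.
  apply: filterS (ae_prefix pf l h0) => y hy Ay; rewrite /Tadj.
  case: ifP => // /set_mem ly; rewrite hy ?mul0r// => -[] /=.
  by rewrite (prefixP ly).2.
move=> /(rM l).1 /reducing_ae; apply=> //.
apply: filterS2 h0 (Top_Tadj pf l h) => x hx ->; rewrite indicE.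
have [lx|lx] := pselect (Z l x); first by rewrite mem_set ?mul1r.
by rewrite hx ?mulr0// => -[].
Qed.

Lemma fills_preimage_sig n A : fills A -> fills (sig n @^-1` A).
Proof.
(* The cylinders of degree [n] cover the path space; other degrees contribute the empty set, so the
   union runs over all of the countable type of paths. *)
move=> fA; apply: (@fillsS (\bigcup_l
    (if kdeg l == n then sig (kdeg l) @^-1` A `&` Z l else set0))).
- by apply: measurable_preimage_sig; case: fA.
- move=> x Ax; exists (iseg x n) => //.
  by rewrite kdeg_iseg eqxx; split=> //; exact: cyl_iseg.
- apply: fills_bigcup_countable => l; case: eqP => _; last exact: fills0.
  exact: fills_preimage_sig_cyl.
Qed.

(** This set is the image by the shift of the part of [A] in Z(l), and the roles of T_l and T_l^*
    are exchanged. *)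
Lemma fills_preimage_prefix l A : fills A -> fills (dom l `&` prefix l @^-1` A).
Proof.
move=> [mA fA]; split.
  by apply: (measurable_prefix pf) => //; exact: measurable_cyl.
move=> h hE h0; have : M (Top f l h).
  apply: fA; first exact: L2on_Top.
  apply: filterS2 (ae_density_sig pf l h0) (ae_density_out pf l) => x hx out Ax.
  rewrite /Top; have [->|/eqP fx] := eqVneq (f l x) 0; first exact: mul0r.
  rewrite hx ?mulr0// => -[_] /=; rewrite prefixK//.
  by apply: contrapT => /out.
move=> /(reducing_Tadj l)/reducing_ae; apply=> //.
apply: filterS2 h0 (Tadj_Top pf l h) => x hx ->; rewrite indicE.
have [lx|lx] := pselect (dom l x); first by rewrite mem_set ?mul1r.
by rewrite hx ?mulr0// => -[].
Qed.

(** The union of the tail equivalence classes, with arbitrary lag, that meet [A]. *)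
Definition saturation A : set X :=
  [set x | exists m n, exists2 s, A s & sig m x = sig n s].

(** With [l] the initial segment of degree [n] of [s], the point [s] is [prefix l (sig m x)]. Only
    countably many [m] and [l] occur. *)
Lemma saturationE A : saturation A =
  \bigcup_m \bigcup_l (sig m @^-1` (dom l `&` prefix l @^-1` A)).
Proof.
apply/seteqP; split => [x [m [n [s As e]]]|x [m _ [l _ [lx Ax]]]].
  exists m => //; exists (iseg s n) => //=.
  have sn := cyl_iseg s n; have := cyl_id_shift sn.
  have := @prefixK _ _ x0 _ _ sn.
  by rewrite kdeg_iseg => sK ls; rewrite e; split => //=; rewrite /sig sK.
exists m, (kdeg l); exists (prefix l (sig m x)) => //.
by rewrite (prefixP lx).2.
Qed.

Lemma fills_saturation A : fills A -> fills (saturation A).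
Proof.
move=> fA; rewrite saturationE.
apply: fills_bigcup_countable => m; apply: fills_bigcup_countable => l.
exact/fills_preimage_sig/fills_preimage_prefix.
Qed.

(** A shift of [x] is absorbed into the degree applied to [x] in one direction, and into the degree
    applied to [s] in the other. *)
Lemma preimage_saturation n A : sig n @^-1` saturation A = saturation A.
Proof.
apply/seteqP; split => x [m [p [s As e]]].
  by exists (addNk m n), p; exists s => //; rewrite -[LHS]/(shift _ x) -shiftD.
exists m, (addNk n p); exists s => //.
have := congr1 (sig n) e; rewrite /sig !shiftD => <-.
by rewrite addNkC.
Qed.

Lemma reducing_full g : minimal_mu_invariant mu E ->
  M g -> ~ {ae mu, forall x, g x = 0} -> M = L2on mu E.
Proof.
move=> [_ minE] Mg gn0; have gE := reducing_L2on Mg.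
have [mE _ sE] := invE.
have fS := fills_saturation (fills_support Mg).
set B := saturation _ in fS; have [mB fB] := fS.
have SB : [set x | g x <> 0] `<=` B.
  by move=> x gx; exists (Nk0 k), (Nk0 k); exists x.
have mEB : measurable (E `&` B) by exact: measurableI.
have inv : mu_invariant mu (E `&` B).
  split=> // [EB0|n].
    (* Since [g] vanishes a.e. off [E] and everywhere off [B], a null intersection would make it
       0. *)
    apply: gn0; case: gE => _ gE0.
    have EB : {ae mu, forall x, ~ (E `&` B) x}.
      by exists (E `&` B); split=> // x /contrapT.
    apply: filterS2 gE0 EB => x gx nEB; apply: contrapT => gx0.
    by apply: nEB; split; [apply: contrapT => /gx|exact: SB].
  have mn (C : set X) : measurable C -> measurable (symdiff C (sig n @^-1` C)).
    move=> mC; have mC' := measurable_preimage_sig n mC.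
    by apply: measurableU; exact: measurableD.
  (* [B] equals its preimage exactly, so the symmetric difference for the intersection lies in the
     one for [E]. *)
  apply: (subset_measure0 (mn _ mEB) (mn _ mE) _ (sE n)).
  rewrite /symdiff preimage_setI preimage_saturation => x [[[Ex Bx] nEB]|[[Ex Bx] nEB]].
    by left; split=> // Ex'; apply: nEB.
  by right; split=> // Ex'; apply: nEB.
have EB0 : mu (symdiff (E `&` B) E) = 0%E.
  by apply: contrapT => EB0; apply: minE; exists (E `&` B).
have aeB : {ae mu, forall x, E x -> B x}.
  exists (symdiff (E `&` B) E); split=> //.
    by apply: measurableU; exact: measurableD.
  by move=> x /= /not_implyP[Ex Bx]; right; split=> // -[].
apply/seteqP; split => h; first exact: reducing_L2on.
(* [E] lies in [B] up to a null set, so every function of L^2(E) is carried by [B]. *)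
move=> hE; apply: fB => //; apply: filterS2 aeB hE.2 => x EBx hx Bx.
by apply: hx => /EBx.
Qed.

End Reducing.

(** [E] may have infinite measure, so its indicator is cut down to a vertex cylinder. There are
    countably many of these and they cover the path space, so one meets [E] in positive measure. *)
Lemma L2on_nontrivial (k : nat) (L : kgraph k) (x0 : ipath L) (R : realType)
    (mu : {measure set IPS x0 -> \bar R}) f E :
  projective_system mu f -> measurable E -> mu E <> 0%E ->
  exists g, L2on mu E g /\ ~ {ae mu, forall x, g x = 0}.
Proof.
move=> pf mE E0.
have [v Ev] : exists v, mu (E `&` Z (kid v)) <> 0%E.
  apply: contrapT => /forallNP Ev; apply: E0.
  pose F n := if unpickle n is Some v then E `&` Z (kid v) else set0.
  apply/(negligibleP mu mE); apply: (@negligibleS _ _ _ _ (\bigcup_n F n)).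
    move=> x Ex; pose v := kr (iseg x (Nk0 k)); exists (pickle v) => //.
    rewrite /F pickleK; split=> //.
    by rewrite /Z /cyl /mkset kdeg_id -iseg0.
  apply: negligible_bigcup => n; rewrite /F.
  case: unpickle => [v|]; last exact: negligible_set0.
  apply/negligibleP; first by apply: measurableI => //; exact: measurable_cyl.
  by apply: contrapT; exact: Ev.
have mEv : measurable (E `&` Z (kid v)).
  by apply: measurableI => //; exact: measurable_cyl.
exists (fun x => (\1_(E `&` Z (kid v)) x)%:C); split.
  split; last by apply: aeW => x Ex; rewrite indicE memNset// => -[].
  split; first exact/cmeas_real/measurable_indic.
  rewrite (eq_integral (fun x => (\1_(E `&` Z (kid v)) x)%:E)); last first.
    by move=> x _; rewrite csq_real indicE; case: (_ \in _); rewrite ?expr1n ?expr0n.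
  rewrite integral_indic// setIT.
  (* Finiteness of the vertex cylinder is the semibranching axiom in degree 0. *)
  case: pf => /(_ (Nk0 k))[_ /(_ (kid v) (kdeg_id v))[_ _ + _ _] _ _ _] _ _ _ _.
  rewrite ks_id; apply: le_lt_trans; apply: le_measure; rewrite ?inE//.
  exact: measurable_cyl.
move=> [N [mN N0 gN]]; apply: Ev; apply: (subset_measure0 mEv mN _ N0) => x Ex.
apply: gN => /=; rewrite indicE (mem_set Ex) => /eqP.
by rewrite -[_ == _]/(_ && _) oner_eq0.
Qed.

Theorem theorem4p20 (k : nat) (hk : (0 < k)%N) (L : kgraph k) (x0 : ipath L)
  (R : realType) (mu : measure (IPS x0) R)
  (f : kmor L -> IPS x0 -> complex R) (E : set (IPS x0)) :
  row_finite L -> source_free L -> no_sinks L ->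
  radon mu -> projective_system mu f ->
  minimal_mu_invariant mu E ->
  irreducible_restriction mu f E.
Proof.
move=> _ _ _ _ pf minE; have [invE _] := minE; have [mE E0 _] := invE.
split.
- by move=> l g; exact: L2on_Top.
- move=> l g gE; exists (Tadj f l g); split; first exact: L2on_Tadj.
  by move=> g' g'2; apply: cinner_Top => //; [exact: g'2.1|exact: gE.1.1].
- exact: (L2on_nontrivial pf).
- move=> M hM rM.
  (* Either [M] has a nonzero member and is everything, or all its members vanish a.e. *)
  have [[g [Mg g0]]|M0] := pselect (exists g, M g /\ ~ {ae mu, forall x, g x = 0}).
    by right; exact: (reducing_full pf invE hM rM minE Mg g0).
  left; apply/seteqP; split => [g Mg|g [gE g0]].
    split; first exact: (reducing_L2on hM).
    by apply: contrapT => g0; apply: M0; exists g.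
  apply: (reducing_ae hM (reducing0 hM) gE).
  by apply: filterS g0 => x ->.
Qed.
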